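(* Let $A$ be a self-adjoint operator on a separable Hilbert space $\mathcal{H}$ which is unbounded above. Then for an arbitrary sequence $(\mathcal{L}_k)_{k\in\mathbb{N}}\in\Lambda(A)$ of finite dimensional subspaces, with corresponding orthogonal projections $P_k:\mathcal{H}\to\mathcal{L}_k$, and for arbitrary sequences of positive numbers $(\varepsilon_k)_{k\in\mathbb{N}}$ decreasing to $0$ and of real numbers $(R_k)_{k\in\mathbb{N}}$ increasing to $+\infty$, there exists a sequence $(\mathcal{L}'_k)_{k\in\mathbb{N}}\in\Lambda(A)$ such that $$\|P_k-P'_k\|<\varepsilon_k\quad\text{and}\quad \mathrm{Spec}(A,\mathcal{L}'_k)\subset(R_k,+\infty)\qquad\text{for all } k\in\mathbb{N},$$ where $P'_k:\mathcal{H}\to\mathcal{L}'_k$ are the corresponding orthogonal projections. Similarly, if $A$ is a self-adjoint operator on a separable Hilbert space $\mathcal{H}$ which is unbounded below, then for all $(\mathcal{L}_k)$, $(\varepsilon_k)$, $(R_k)$ as described there exists $(\mathcal{L}'_k)_{k\in\mathbb{N}}\in\Lambda(A)$ such that $\|P_k-P'_k\|<\varepsilon_k$ and $\mathrm{Spec}(A,\mathcal{L}'_k)\subset(-\infty,-R_k)$ for all $k\in\mathbb{N}$.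
   Context: Hilbert spaces are complex. $\mathrm{Dom}(A)$ is the domain of the self-adjoint operator $A$. $A$ is unbounded above (below) if its spectrum is not bounded above (below). $\Lambda(A)$ is the set of all sequences $(\mathcal{L}_k)_{k\in\mathbb{N}}$ of closed (in $\mathcal{H}$) linear subspaces of $\mathcal{H}$, each contained in $\mathrm{Dom}(A)$, such that the orthogonal projections $P_k:\mathcal{H}\to\mathcal{L}_k$ converge strongly to the identity operator $I$. For a closed subspace $\mathcal{L}\subseteq\mathrm{Dom}(A)$ with orthogonal projection $P:\mathcal{H}\to\mathcal{L}$, $\mathrm{Spec}(A,\mathcal{L})$ denotes the spectrum of the operator $PA:\mathcal{L}\to\mathcal{L}$. Projections are compared in operator norm, regarded as operators on $\mathcal{H}$. *)

(* Defs.v *)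
From mathcomp Require Import all_boot all_order all_algebra.
From mathcomp Require Import all_classical all_reals all_analysis.
From mathcomp Require Import complex.

Set Implicit Arguments.
Unset Strict Implicit.
Unset Printing Implicit Defensive.

Import Order.TTheory GRing.Theory Num.Theory.
Import numFieldNormedType.Exports.

Local Open Scope classical_set_scope.
Local Open Scope ring_scope.
Local Open Scope complex_scope.

(* The norm of [H] takes values in [R[i]] and is the one induced by the inner
   product, so completeness of [H] is completeness for that norm. *)
Record hilbertType (R : realType) := Hilbert {
  hilbert_sort :> completeNormedModType R[i] ;
  inner : {dot hilbert_sort for Num.conj} ;
  inner_norm : forall x : hilbert_sort, inner x x = `|x| ^+ 2 }.

Definition separable (T : topologicalType) : Prop :=
  exists S : set T, countable S /\ dense S.

Section Hilbert.
Variables (R : realType) (H : hilbertType R).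

(* An unbounded operator; the values of [op] outside [dom] are irrelevant. *)
Record operator := Operator {
  dom : set H ;
  op :> H -> H ;
  dom_submod : submod_closed (mem dom) ;
  op_linear : forall (a : R[i]) (x y : H), dom x -> dom y ->
    op (a *: x + y) = a *: op x + op y }.

Definition graph (A : operator) : set (H * H) :=
  [set p | dom A p.1 /\ A p.1 = p.2].

Definition adjoint_graph (A : operator) : set (H * H) :=
  [set p | forall x, dom A x -> inner H (A x) p.1 = inner H x p.2].

Definition self_adjoint (A : operator) : Prop :=
  dense (dom A) /\ graph A = adjoint_graph A.

(* Resolvent set and spectrum of an operator [T : D -> E], where the subspace
   [E] plays the role of the ambient Hilbert space and [D] is a subspace of
   [E]. *)
Definition resolvent_set (D E : set H) (T : H -> H) : set R[i] :=
  [set z | exists S : H -> H,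
    [/\ forall y, E y -> D (S y) /\ T (S y) - z *: S y = y,
        forall x, D x -> E (T x - z *: x) /\ S (T x - z *: x) = x
      & exists M : R, forall y, E y -> `|S y| <= M%:C * `|y|]].

Definition spectrum (D E : set H) (T : H -> H) : set R[i] :=
  ~` resolvent_set D E T.

Definition Spec (A : operator) : set R[i] := spectrum (dom A) setT A.

(* The spectrum of a self-adjoint operator is real: taking real parts below
   only moves it from [R[i]] to [R]. *)
Definition unbounded_above (A : operator) : Prop :=
  ~ has_ubound [set complex.Re z | z in Spec A].

Definition unbounded_below (A : operator) : Prop :=
  ~ has_lbound [set complex.Re z | z in Spec A].

Definition closed_subspace (L : set H) : Prop :=
  submod_closed (mem L) /\ closed L.

Definition finite_dimensional (L : set H) : Prop :=
  exists n (e : 'I_n -> H),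
    L = [set v | exists c : 'I_n -> R[i], v = \sum_(i < n) c i *: e i].

(* For a closed subspace [L], the point selected by [xget] exists and is
   unique. *)
Definition orthoproj (L : set H) (x : H) : H :=
  xget 0 [set y | L y /\ forall v, L v -> inner H (x - y) v = 0].

Definition Lambda (A : operator) : set (nat -> set H) :=
  [set L | (forall k, closed_subspace (L k) /\ L k `<=` dom A) /\
           (forall x : H, (fun k => orthoproj (L k) x) @ \oo --> x)].

Definition SpecIn (A : operator) (L : set H) : set R[i] :=
  spectrum L L (fun x => orthoproj L (A x)).

(* [`|T x|] is a nonnegative real number in [R[i]], hence [complex.Re]. *)
Definition opnorm (T : H -> H) : \bar R :=
  ereal_sup [set (complex.Re `|T x|)%:E | x in [set x : H | `|x| <= 1]].

End Hilbert.

(* Main.v *)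
Require Import Defs.
From mathcomp Require Import all_boot all_order all_algebra.
From mathcomp Require Import all_classical all_reals all_analysis.
From mathcomp Require Import complex ring lra.

(* Fix k and an orthonormal basis e_1, ..., e_n of L_k.  If the form <Ax, x> is
   unbounded above on Dom(A), it remains so on the vectors of Dom(A) orthogonal
   to any finite set, so one finds orthonormal f_1, ..., f_n in Dom(A),
   orthogonal to all e_j and A e_j, with <A f_i, f_j> = 0 for i <> j and
   <A f_i, f_i> > M.  For c^2 + t^2 = 1 let L'_k be spanned by the orthonormal
   vectors c e_i + t f_i.  The cross terms of the form vanish on L'_k, so it is
   at least t^2 M - sum_i |A e_i| there: take t small enough for the norm bound,
   then M large.  That the form is unbounded when the spectrum is follows from
   the fact that if <Ax, x> <= c |x|^2 on Dom(A) and Re z > c, then A - z is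
   bounded below, and its range is closed with trivial orthogonal complement.
   The two halves of the theorem are the cases s = 1 and s = -1 of one argument
   about the form s <Ax, x>. *)

Set Implicit Arguments.
Unset Strict Implicit.
Unset Printing Implicit Defensive.

Import Order.TTheory GRing.Theory Num.Theory.
Import numFieldNormedType.Exports.

Local Open Scope classical_set_scope.
Local Open Scope ring_scope.
Local Open Scope complex_scope.

(** * Hilbert space geometry *)

Section InnerProduct.
Variables (R : realType) (H : hilbertType R).
Implicit Types (x y z : H) (a : R[i]).

(* The norm of [H] is valued in [R[i]]; working with its real part gives access
   to the total order of [R]. *)
Definition nm (x : H) : R := complex.Re `|x|.
Local Notation re := complex.Re.

Lemma ReD (a b : R[i]) : re (a + b) = re a + re b.
Proof. by case: a b => [? ?] [? ?]. Qed.
Lemma ReN (a : R[i]) : re (- a) = - re a.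
Proof. by case: a. Qed.
Lemma ReC (a : R[i]) : re a^* = re a.
Proof. by case: a. Qed.
Lemma ReM_real (r : R) (a : R[i]) : re (r%:C * a) = r * re a.
Proof. by case: a => x y /=; rewrite mul0r subr0. Qed.
Lemma ler_Re_norm (a : R[i]) : re a <= re `|a|.
Proof.
have := normc_ge_Re a; rewrite lecE => /andP[_ /=].
exact/le_trans/ler_norm.
Qed.
Lemma Re_norm_ge0 (a : R[i]) : 0 <= re `|a|.
Proof. by have := normr_ge0 a; rewrite lecE => /andP[]. Qed.
Lemma normcRe (a : R[i]) : `|a| = (re `|a|)%:C.
Proof. by rewrite RRe_real // normr_real. Qed.

Lemma nmE x : `|x| = (nm x)%:C.
Proof. by rewrite /nm RRe_real // normr_real. Qed.
Lemma nm_ge0 x : 0 <= nm x.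
Proof. by rewrite -ler0c -nmE. Qed.
Lemma nm_eq0 x : nm x = 0 -> x = 0.
Proof. by move=> h; apply/eqP; rewrite -normr_eq0 nmE h. Qed.
Lemma nm0 : nm 0 = 0.
Proof. by rewrite /nm normr0. Qed.
Lemma nmN x : nm (- x) = nm x.
Proof. by rewrite /nm normrN. Qed.
Lemma nm_distC x y : nm (x - y) = nm (y - x).
Proof. by rewrite -nmN opprB. Qed.
Lemma nmD x y : nm (x + y) <= nm x + nm y.
Proof. by rewrite -lecR rmorphD /= -!nmE ler_normD. Qed.
Lemma nmB x y : nm (x - y) <= nm x + nm y.
Proof. by rewrite -[nm y]nmN nmD. Qed.
Lemma nmZ a x : nm (a *: x) = re `|a| * nm x.
Proof. by apply: (@complexI R); rewrite rmorphM /= -normcRe -!nmE normrZ. Qed.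
Lemma nm_real (r : R) x : nm (r%:C *: x) = `|r| * nm x.
Proof. by rewrite nmZ normc_def /= expr0n addr0 sqrtr_sqr. Qed.

Lemma nm_sum (I : Type) (s : seq I) (F : I -> H) :
  nm (\sum_(i <- s) F i) <= \sum_(i <- s) nm (F i).
Proof.
elim: s => [|i s ih]; first by rewrite !big_nil nm0.
by rewrite !big_cons (le_trans (nmD _ _)) // lerD2l.
Qed.

Local Notation ip := (inner H).

Lemma ipC x y : ip y x = conjc (ip x y).
Proof. by rewrite (hermC (inner H) y x) expr0 mul1r. Qed.
Lemma ip0l x : ip 0 x = 0. Proof. exact: linear0l. Qed.
Lemma ip0r x : ip x 0 = 0. Proof. exact: linear0r. Qed.
Lemma ipDl x y z : ip (x + y) z = ip x z + ip y z. Proof. exact: linearDl. Qed.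
Lemma ipDr x y z : ip x (y + z) = ip x y + ip x z. Proof. exact: linearDr. Qed.
Lemma ipBl x y z : ip (x - y) z = ip x z - ip y z. Proof. exact: linearBl. Qed.
Lemma ipBr x y z : ip x (y - z) = ip x y - ip x z. Proof. exact: linearBr. Qed.
Lemma ipZl a x y : ip (a *: x) y = a * ip x y. Proof. exact: linearZl_LR. Qed.
Lemma ipZr a x y : ip x (a *: y) = conjc a * ip x y. Proof. exact: linearZr_LR. Qed.
Lemma ip_suml I (s : seq I) (F : I -> H) y :
  ip (\sum_(i <- s) F i) y = \sum_(i <- s) ip (F i) y.
Proof. exact: linear_sumlz. Qed.
Lemma ip_sumr I (s : seq I) (F : I -> H) y :
  ip y (\sum_(i <- s) F i) = \sum_(i <- s) ip y (F i).
Proof. exact: linear_sumr. Qed.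
Lemma ip_nm x : ip x x = (nm x ^+ 2)%:C.
Proof. by rewrite inner_norm nmE rmorphXn. Qed.
Lemma ip_eq0C x y : ip x y = 0 -> ip y x = 0.
Proof. by move=> h; rewrite ipC h conjc0. Qed.

Lemma nmD_sq x y : nm (x + y) ^+ 2 = nm x ^+ 2 + nm y ^+ 2 + 2 * re (ip x y).
Proof.
have -> : nm (x + y) ^+ 2 = re (ip (x + y) (x + y)) by rewrite ip_nm.
rewrite ipDl !ipDr !ReD !ip_nm /= (ipC x y) ReC; ring.
Qed.

Lemma nmB_sq x y : nm (x - y) ^+ 2 = nm x ^+ 2 + nm y ^+ 2 - 2 * re (ip x y).
Proof.
rewrite nmD_sq nmN -[- y]scaleN1r ipZr rmorphN rmorph1 mulN1r ReN; ring.
Qed.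

(** Cauchy-Schwarz, from Pythagoras for the splitting of [x] into its component [b *: y] along [y]
    and an orthogonal remainder. *)
Lemma norm_ip_le x y : re `|ip x y| <= nm x * nm y.
Proof.
have [y0|y0] := eqVneq (nm y) 0.
  by rewrite (nm_eq0 y0) ip0r normr0 nm0 mulr0.
have yp : 0 < nm y by rewrite lt_def y0 nm_ge0.
pose b := ip x y / (nm y ^+ 2)%:C.
have hy : (nm y ^+ 2)%:C != 0 :> R[i] by rewrite -(rmorph0 (real_complex R)) (inj_eq (@complexI R)) expf_neq0.
have h : ip (x - b *: y) (b *: y) = 0.
  rewrite ipZr ipBl ipZl ip_nm /b divfK // subrr mulr0 //.
have := nmD_sq (x - b *: y) (b *: y).
rewrite subrK h /= mulr0 addr0 nmZ => e.
have hb : re `|b| * nm y ^+ 2 = re `|ip x y|.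
  have -> : ip x y = b * (nm y ^+ 2)%:C by rewrite divfK.
  rewrite normrM (ger0_norm (_ : 0 <= (nm y ^+ 2)%:C)) ?ler0c ?exprn_ge0 ?nm_ge0 //.
  by rewrite mulrC ReM_real mulrC.
have : (re `|ip x y|) ^+ 2 <= (nm x * nm y) ^+ 2.
  rewrite exprMn e -hb mulrDl [X in _ <= _ + X](_ : _ = (re `|b| * nm y ^+ 2) ^+ 2); last by ring.
  by rewrite lerDr mulr_ge0 // exprn_ge0 // nm_ge0.
by rewrite ler_sqr // nnegrE ?Re_norm_ge0 // mulr_ge0 // nm_ge0.
Qed.

Lemma re_ip_le x y : re (ip x y) <= nm x * nm y.
Proof. exact: le_trans (ler_Re_norm _) (norm_ip_le _ _). Qed.
Lemma re_ip_ge x y : - (nm x * nm y) <= re (ip x y).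
Proof.
rewrite lerNl -ReN; apply: le_trans (ler_Re_norm _) _.
by rewrite normrN norm_ip_le.
Qed.

Lemma cvg_nmP (u : nat -> H) x :
  (u @ \oo --> x) <->
  (forall e : R, 0 < e -> exists N : nat, forall n, (N <= n)%N -> nm (u n - x) < e).
Proof.
split=> [/cvgrPdistC_lt h e e0|h].
  have /h [N _ hN] : (0 : R[i]) < e%:C by rewrite ltcR.
  by exists N => n /hN /=; rewrite nmE ltcR.
apply/cvgrPdistC_lt => e e0.
have eE : e = (re e)%:C by rewrite RRe_real // gtr0_real.
have /h[N hN] : 0 < re e by rewrite -ltcR -eE.
by exists N => // n /= /hN; rewrite nmE eE ltcR.
Qed.

(** Completeness of [H] enters in this form, with real tolerances in place of positive elements of
    [R[i]]. *)
Lemma cauchy_nm (u : nat -> H) :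
  (forall e : R, 0 < e -> exists N : nat, forall n m,
      (N <= n)%N -> (N <= m)%N -> nm (u n - u m) < e) ->
  exists x, u @ \oo --> x.
Proof.
move=> h; exists (lim (u @ \oo)).
apply: cauchy_cvg; apply/cauchy_exP => e e0.
have eE : e = (re e)%:C by rewrite RRe_real // gtr0_real.
have /h[N hN] : 0 < re e by rewrite -ltcR -eE.
exists (u N); exists N => // n /= Nn.
by rewrite -ball_normE /= eE nmE ltcR; apply: hN.
Qed.

End InnerProduct.

(** * Spectral bound from a bound on the form *)

Section Spectrum.
Variables (R : realType) (H : hilbertType R).
Implicit Types (x y z : H) (a : R[i]).
Local Notation re := complex.Re.
Local Notation ip := (inner H).

Definition invS (n : nat) : R := n.+1%:R^-1.
Lemma invS_gt0 n : 0 < invS n.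
Proof. by rewrite invr_gt0. Qed.

Lemma inv_succ_lt (e : R) : 0 < e -> exists N : nat, forall n, (N <= n)%N -> invS n < e.
Proof.
move=> e0; have [N hN] : exists N : nat, e^-1 < N.+1%:R.
  exists (Num.Def.truncn e^-1); have := @truncnS_gt R e^-1; exact.
exists N => n Nn; rewrite /invS invf_plt ?posrE //.
by apply: lt_le_trans hN _; rewrite ler_nat ltnS.
Qed.

Lemma le_addeps (u v : R) : (forall e : R, 0 < e -> u <= v + e) -> u <= v.
Proof. by move=> h; apply/ler_addgt0Pr. Qed.

Lemma submod_set (M : set H) : submod_closed (mem M) ->
  M 0 /\ forall a x y, M x -> M y -> M (a *: x + y).
Proof.
case=> M0 hM; split; first by move: M0; rewrite inE.
by move=> a x y Mx My; have := hM a x y; rewrite !inE; apply.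
Qed.

Lemma submodP (M : set H) :
  M 0 -> (forall a x y, M x -> M y -> M (a *: x + y)) -> submod_closed (mem M).
Proof.
by move=> M0 h; split; rewrite ?inE // => a x y; rewrite !inE; apply: h.
Qed.

Lemma closed_nm (M : set H) :
  (forall p, (forall e : R, 0 < e -> exists2 v, M v & nm (v - p) < e) -> M p) ->
  closed M.
Proof.
move=> h p cp; apply: h => e e0.
have [|v [Mv]] := cp (ball p e%:C); first by apply: nbhsx_ballx; rewrite ltcR.
by rewrite -ball_normE /= nmE ltcR nm_distC => hv; exists v.
Qed.

(** The point [w] of [M] nearest to [y] is the limit of a minimizing sequence; [y - w] is orthogonal
    to [M], hence zero. *)
Lemma closed_submod_total (M : set H) :
  submod_closed (mem M) -> closed M ->
  (forall y, (forall v, M v -> ip v y = 0) -> y = 0) -> forall y, M y.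
Proof.
move=> /submod_set [M0 Ml] cM tM y.
pose D := [set nm (y - v) | v in M].
have hD : has_inf D.
  split; first by exists (nm (y - 0)), 0.
  by exists 0 => _ [v _ <-]; apply: nm_ge0.
pose d : R := inf D.
have dle v : M v -> d <= nm (y - v).
  by move=> Mv; apply: ge_inf; [case: hD | exists v].
have d0 : 0 <= d by apply: lb_le_inf; [case: hD | move=> _ [v _ <-]; apply: nm_ge0].
have exv (n : nat) : exists v, M v /\ nm (y - v) < d + invS n.
  have [_ [v Mv <-] hv] := @inf_adherent _ D (invS n) (invS_gt0 n) hD.
  by exists v.
have {exv} [u hu] := choice exv.
have Mhalf v w : M v -> M w -> M (2^-1%:C *: (v + w)).
  by move=> Mv Mw; rewrite -[_ *: _]addr0; apply: (Ml) => //; rewrite -[v]scale1r; apply: (Ml).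
have [w cw] : exists w : H, u @ \oo --> w.
  apply: cauchy_nm => e e0.
  (* With [a = invS n] and [b = invS m] below 1, the parallelogram law bounds the squared distance
     by [(4 * d + 2) * (a + b)], which is less than [e ^+ 2] once [a] and [b] are less than
     [e ^+ 2 / (8 * d + 5)]. *)
  have K0 : 0 < 8 * d + 5 by lra.
  have [N hN] := @inv_succ_lt (Num.min 1 (e ^+ 2 / (8 * d + 5))) ltac:(by rewrite lt_min ltr01 divr_gt0 ?exprn_gt0).
  exists N => n m /hN + /hN.
  rewrite !lt_min => /andP[n1 n2] /andP[m1 m2].
  have [Mn ln] := hu n; have [Mm lm] := hu m.
  have dn := dle _ Mn; have dm := dle _ Mm.
  have dh := dle _ (Mhalf _ _ Mn Mm).
  (* Parallelogram law: a minimizing sequence is Cauchy. *)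
  have e1 : nm (u n - u m) ^+ 2 + 4 * nm (y - 2^-1%:C *: (u n + u m)) ^+ 2 =
            2 * nm (y - u n) ^+ 2 + 2 * nm (y - u m) ^+ 2.
    have -> : u n - u m = (y - u m) - (y - u n) by rewrite opprB [RHS]addrC addrA subrK.
    rewrite (nmB_sq (y - u m)).
    have -> : y - 2^-1%:C *: (u n + u m) = 2^-1%:C *: ((y - u m) + (y - u n)).
      rewrite addrACA -opprD scalerBr (addrC (u m)); congr (_ - _).
      by rewrite -(mulr2n y) -(scaler_nat _ y) scalerA -(rmorph_nat (real_complex R)) -rmorphM /= mulVf // scale1r.
    rewrite nm_real exprMn (nmD_sq (y - u m)) ger0_norm ?invr_ge0 //; by field.
  have q : nm (u n - u m) ^+ 2 < e ^+ 2.
    have n0 : 0 <= invS n by apply/ltW/invS_gt0.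
    have m0 : 0 <= invS m by apply/ltW/invS_gt0.
    set a := invS n in ln n1 n2 n0; set b := invS m in lm m1 m2 m0.
    move: n2 m2; rewrite !ltr_pdivlMr // => n2 m2.
    have s1 : nm (y - u n) ^+ 2 <= (d + a) ^+ 2 by rewrite ler_sqr ?nnegrE ?nm_ge0 ?addr_ge0 // ltW.
    have s2 : nm (y - u m) ^+ 2 <= (d + b) ^+ 2 by rewrite ler_sqr ?nnegrE ?nm_ge0 ?addr_ge0 // ltW.
    have s3 : d ^+ 2 <= nm (y - 2^-1%:C *: (u n + u m)) ^+ 2 by rewrite ler_sqr ?nnegrE ?nm_ge0.
    have s4 : a ^+ 2 <= a by rewrite expr2 ler_piMl // ltW.
    have s5 : b ^+ 2 <= b by rewrite expr2 ler_piMl // ltW.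
    lra.
  by move: q; rewrite ltr_sqr ?nnegrE ?nm_ge0 // ltW.
have Mw : M w by apply: (closed_cvg M cM _ w cw); apply: nearW => n; case: (hu n).
have dw : nm (y - w) <= d.
  apply: le_addeps => e e0.
  have [N1 hN1] := @inv_succ_lt (e / 2) ltac:(by lra).
  have [N2 hN2] := (cvg_nmP u w).1 cw (e / 2) ltac:(by lra).
  have k1 := hN1 _ (leq_maxl N1 N2); have k2 := hN2 _ (leq_maxr N1 N2).
  have [_ k3] := hu (maxn N1 N2).
  have -> : y - w = (y - u (maxn N1 N2)) + (u (maxn N1 N2) - w) by rewrite addrA subrK.
  apply: le_trans (nmD _ _) _; lra.
(* Were this real part [p] positive, moving [w] by [t%:C *: v] would bring it strictly closer to
   [y]: the squared distance changes by [t * (t * nm v ^+ 2 - 2 * p) < 0]. *)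
have half v : M v -> re (ip (y - w) v) <= 0.
  move=> Mv; rewrite leNgt; apply/negP => p0.
  pose t := re (ip (y - w) v) / (nm v ^+ 2 + 1).
  have v1 : 0 < nm v ^+ 2 + 1 by rewrite ltr_wpDl ?exprn_ge0 ?nm_ge0.
  have t0 : 0 < t by rewrite divr_gt0.
  have := dle (t%:C *: v + w) (Ml _ _ _ Mv Mw).
  have -> : y - (t%:C *: v + w) = (y - w) - t%:C *: v by rewrite opprD addrA addrAC.
  have := nmB_sq (y - w) (t%:C *: v).
  rewrite ipZr conjc_real ReM_real nm_real gtr0_norm //.
  have et : t * (nm v ^+ 2 + 1) = re (ip (y - w) v) by rewrite divfK // gt_eqF.
  move=> e1 e2; have := nm_ge0 (y - w); have := nm_ge0 (y - w - t%:C *: v).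
  move: et e1 e2 dw t0 p0 d0.
  set p := re _; set q := nm (_ - _ - _); set k := nm (y - w) => et e1 e2 dw t0 p0 d0 q0 k0.
  have s1 : k ^+ 2 <= d ^+ 2 by rewrite ler_sqr ?nnegrE.
  have s2 : d ^+ 2 <= q ^+ 2 by rewrite ler_sqr ?nnegrE.
  have : t * (t * nm v ^+ 2 - 2 * p) < 0.
    by rewrite pmulr_rlt0 //; nra.
  nra.
suff -> : y = w by [].
apply/eqP; rewrite -subr_eq0; apply/eqP; apply: tM => v Mv.
(* This multiple of [v] turns the bound on the real part into one on the squared modulus of
   [ip (y - w) v]. *)
have := half (ip (y - w) v *: v).
rewrite ipZr mulrC -sqr_normc normcRe -rmorphXn /= => /(_ _) hh.
have {hh} hh : re `|ip (y - w) v| ^+ 2 <= 0.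
  by apply: hh; rewrite -[_ *: _]addr0; apply: (Ml).
apply: ip_eq0C; apply/eqP; rewrite -normr_eq0 normcRe.
suff -> : re `|ip (y - w) v| = 0 by [].
by apply/eqP; rewrite -sqrf_eq0 eq_le hh sqr_ge0.
Qed.

Variable A : operator H.
Hypothesis sA : self_adjoint A.

Lemma sa_sym x y : dom A x -> dom A y -> ip (A x) y = ip x (A y).
Proof.
move=> Dx Dy; case: sA => _ /seteqP [h _].
exact: (h (y, A y) (conj Dy erefl)).
Qed.

(** This half of self-adjointness puts limits, and vectors orthogonal to a range, into the
    domain. *)
Lemma sa_adj x y : (forall u, dom A u -> ip (A u) x = ip u y) -> dom A x /\ A x = y.
Proof. by move=> h; case: sA => _ /seteqP [_ /(_ (x, y)) k]; exact: k. Qed.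

Lemma form_real x : dom A x -> ip (A x) x = (re (ip (A x) x))%:C.
Proof.
move=> Dx; rewrite RRe_real //; apply/Num.Theory.CrealP.
by rewrite -[LHS]ipC sa_sym.
Qed.

Lemma domD x y a : dom A x -> dom A y -> dom A (a *: x + y).
Proof. by case: (submod_set (dom_submod A)) => _; apply. Qed.
Lemma dom0 : dom A 0.
Proof. by case: (submod_set (dom_submod A)). Qed.

Lemma op0 : A 0 = 0.
Proof.
have := op_linear 1 dom0 dom0; rewrite !scale1r addr0 => e.
by apply: (addrI (A 0)); rewrite addr0 -e.
Qed.

Lemma domZ x a : dom A x -> dom A (a *: x).
Proof. by move=> Dx; rewrite -[_ *: _]addr0; apply: domD => //; apply: dom0. Qed.

Lemma domA x y : dom A x -> dom A y -> dom A (x + y).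
Proof. by move=> Dx Dy; rewrite -[x]scale1r; apply: domD. Qed.

Lemma opZ x a : dom A x -> A (a *: x) = a *: A x.
Proof. by move=> Dx; have := op_linear a Dx dom0; rewrite op0 !addr0. Qed.

Lemma opD x y : dom A x -> dom A y -> A (x + y) = A x + A y.
Proof. by move=> Dx Dy; have := op_linear 1 Dx Dy; rewrite !scale1r. Qed.

Lemma opB x y : dom A x -> dom A y -> A (x - y) = A x - A y.
Proof.
by move=> Dx Dy; rewrite -scaleN1r addrC op_linear // scaleN1r addrC.
Qed.

Lemma domB x y : dom A x -> dom A y -> dom A (x - y).
Proof. by move=> Dx Dy; rewrite -scaleN1r addrC; apply: domD. Qed.

(** If [s * re z] exceeds [c] by [d > 0], then [A - z] is bounded below by [d] and maps the domain
    onto [H], so it has an inverse bounded by [d^-1]. *)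
Lemma Spec_le (s c : R) (z : R[i]) : `|s| = 1 ->
  (forall x, dom A x -> s * re (ip (A x) x) <= c * nm x ^+ 2) ->
  Spec A z -> s * re z <= c.
Proof.
move=> s1 hc; apply: contraPP => /negP; rewrite -ltNge => cz; apply.
pose d := s * re z - c; have d0 : 0 < d by rewrite subr_gt0.
(* Pairing [A x - z *: x] with [x] gives a real part which, multiplied by [s], is at most
   [- d * nm x ^+ 2]; Cauchy-Schwarz concludes. *)
have low x : dom A x -> d * nm x <= nm (A x - z *: x).
  move=> Dx; have := nm_ge0 x; rewrite le_eqVlt => /orP[/eqP <-|x0].
    by rewrite mulr0 nm_ge0.
  rewrite -(ler_pM2r x0) -mulrA -expr2.
  have h : re (ip (A x - z *: x) x) = re (ip (A x) x) - re z * nm x ^+ 2.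
    by rewrite ipBl ipZl ip_nm ReD ReN mulrC ReM_real mulrC.
  have := re_ip_le (A x - z *: x) x; have := re_ip_ge (A x - z *: x) x.
  have := hc _ Dx; rewrite h /d.
  have : s ^+ 2 = 1 by rewrite -real_normK ?num_real // s1 expr1n.
  set q := re (ip _ _); set n := nm x ^+ 2; set m := _ * nm x.
  have [s0|s0] := lerP 0 s.
    by have -> : s = 1; [move: s1; rewrite ger0_norm | move=> _ *; nra].
  by have -> : s = -1; [move: s1; rewrite ltr0_norm // => /eqP; rewrite eqr_oppLR => /eqP | move=> _ *; nra].
pose M := [set A x - z *: x | x in dom A].
have subM : submod_closed (mem M).
  apply: submodP; first by exists 0; rewrite ?op0 ?scaler0 ?subr0 //; apply: dom0.
  move=> a _ _ [x Dx <-] [y Dy <-]; exists (a *: x + y); first exact: domD.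
  rewrite op_linear // scalerBr scalerDr !scalerA (mulrC z) opprD -!addrA; congr (_ + _).
  by rewrite addrCA.
(* Values of [A - z] converging to [p] have preimages that are Cauchy by [low]; their limit is a
   preimage of [p]. *)
have cM : closed M.
  apply: closed_nm => p hp.
  have {hp} hp (n : nat) : exists x, dom A x /\ nm (A x - z *: x - p) < invS n.
    by have [|_ [x Dx <-] hx]   := hp (invS n); [exact: invS_gt0 | exists x].
  have [u hu] := choice hp.
  have [x cx] : exists x : H, u @ \oo --> x.
    apply: cauchy_nm => e e0.
    have [N hN] := @inv_succ_lt (d * e / 2) ltac:(by rewrite divr_gt0 // mulr_gt0).
    exists N => n m /hN n1 /hN m1.
    have [Dn n2] := hu n; have [Dm m2] := hu m.
    rewrite -(ltr_pM2l d0); apply: le_lt_trans (low _ (domB Dn Dm)) _.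
    have -> : A (u n - u m) - z *: (u n - u m) = (A (u n) - z *: u n - p) - (A (u m) - z *: u m - p).
      rewrite opB // scalerBr (opprB _ p) [RHS]addrA subrK.
      by rewrite !opprD !opprK [LHS]addrACA.
    apply: le_lt_trans (nmB _ _) _; lra.
  (* For each [v] in the domain, the identity [ip (A v) (u n) = ip v (A (u n))] passes to the
     limit. *)
  have [Dx Ax] : dom A x /\ A x = p + z *: x.
    apply: sa_adj => v Dv; apply/eqP; rewrite -subr_eq0; apply/eqP.
    apply/eqP; rewrite -normr_eq0 normcRe.
    suff -> : re `|ip (A v) x - ip v (p + z *: x)| = 0 by [].
    apply/eqP; rewrite eq_le Re_norm_ge0 andbT; apply: le_addeps => e e0; rewrite add0r.
    (* The error is at most [nm v * (1 + re |z|) + nm (A v)] times [e / K]; the extra 1 keeps [K]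
       positive. *)
    pose K := nm (A v) + nm v * (1 + re `|z|) + 1.
    have K1 : 0 <= nm v * (1 + re `|z|) by rewrite mulr_ge0 ?nm_ge0 // addr_ge0 ?Re_norm_ge0.
    have K0 : 0 < K by have := nm_ge0 (A v); rewrite /K; lra.
    have [N1 hN1] := @inv_succ_lt (e / K) ltac:(by rewrite divr_gt0).
    have [N2 hN2] := (cvg_nmP u x).1 cx (e / K) ltac:(by rewrite divr_gt0).
    have k1 := hN1 _ (leq_maxl N1 N2); have k2 := hN2 _ (leq_maxr N1 N2).
    have [Dn k3] := hu (maxn N1 N2); set n := maxn N1 N2 in k1 k2 k3 Dn.
    have -> : ip (A v) x - ip v (p + z *: x) =
        ip v ((A (u n) - z *: u n - p) + z *: (u n - x)) - ip (A v) (u n - x).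
      rewrite (_ : _ + _ = A (u n) - (p + z *: x)); last first.
        by rewrite scalerBr opprD addrA (addrAC _ (- p)) addrA subrK addrAC.
      by rewrite !ipBr -(sa_sym Dv Dn); ring.
    rewrite -lecR -normcRe; apply: le_trans (ler_normB _ _) _.
    rewrite (normcRe (ip v _)) (normcRe (ip (A v) _)) -rmorphD /= lecR.
    apply: le_trans (lerD (norm_ip_le _ _) (norm_ip_le _ _)) _.
    have b1 : nm (A (u n) - z *: u n - p + z *: (u n - x)) <= (1 + re `|z|) * (e / K).
      apply: le_trans (nmD _ _) _; rewrite nmZ mulrDl mul1r; apply: lerD; first lra.
      by rewrite ler_wpM2l ?Re_norm_ge0 // ltW.
    apply: le_trans (lerD (ler_wpM2l (nm_ge0 _) b1) (ler_wpM2l (nm_ge0 _) (ltW k2))) _.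
    have : 0 < e / K by rewrite divr_gt0.
    have : (e / K) * K = e by rewrite divfK // gt_eqF.
    rewrite {2}/K; set t := e / K => et t0; nra.
  by exists x => //; rewrite Ax addrK.
(* Such a [y] satisfies [A y = conjc z *: y], so the form at [y] is [s * re z * nm y ^+ 2], which
   violates the bound by [c] unless [y = 0]. *)
have tM y : (forall v, M v -> ip v y = 0) -> y = 0.
  move=> hy; have [Dy Ay] : dom A y /\ A y = conjc z *: y.
    apply: sa_adj => u Du; have := hy _ (ex_intro2 _ _ u Du erefl).
    by rewrite ipBl ipZl ipZr conjcK => /eqP; rewrite subr_eq0 => /eqP.
  apply: nm_eq0; have := hc _ Dy.
  rewrite Ay ipZl ip_nm (mulrC (conjc z)) ReM_real ReC => h.
  have : d * nm y ^+ 2 <= 0 by rewrite /d; lra.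
  rewrite pmulr_rle0 // => h2; apply/eqP.
  by rewrite -sqrf_eq0 eq_le h2 sqr_ge0.
have surj y : exists x, dom A x /\ A x - z *: x = y.
  by have [x Dx <-] := closed_submod_total subM cM tM y; exists x.
have [S hS] := choice surj.
exists S; split.
- by move=> y _; apply: hS.
- move=> x Dx; split=> //; have [Dy ey] := hS (A x - z *: x).
  apply/eqP; rewrite -subr_eq0; apply/eqP; apply: nm_eq0.
  have := low _ (domB Dy Dx).
  rewrite opB // scalerBr opprD opprK addrACA ey addrACA subrr add0r addNr nm0.
  by rewrite pmulr_rle0 // => h; apply/eqP; rewrite eq_le h nm_ge0.
- exists d^-1 => y _; have [Dy ey] := hS y.
  rewrite !nmE -rmorphM lecR ler_pdivlMl //.
  by have := low _ Dy; rewrite ey.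
Qed.

End Spectrum.

(** * Vectors of large energy *)

Section UnboundedForm.
Variables (R : realType) (H : hilbertType R) (A : operator H).
Hypothesis sA : self_adjoint A.
Variable s : R.
Hypothesis s1 : `|s| = 1.
Local Notation re := complex.Re.
Local Notation ip := (inner H).

Definition form (x : H) : R := s * re (ip (A x) x).

(** The strict inequality forces the witness to be nonzero, so it can be normalized. *)
Definition unbounded_form (V : set H) :=
  forall c, exists2 x, V x & c * nm x ^+ 2 < form x.

Lemma sRe_le (z : R[i]) : s * re z <= re `|z|.
Proof.
apply: le_trans (ler_norm _) _; rewrite normrM s1 mul1r.
by have := normc_ge_Re z; rewrite lecE => /andP[].
Qed.

Lemma unbounded_form_perp (V : set H) (u : H) :
  submod_closed (mem V) -> V `<=` dom A -> unbounded_form V ->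
  unbounded_form (V `&` [set x | ip x u = 0]).
Proof.
move=> /submod_set [V0 Vl] VD uV.
have [pu|] := pselect (forall x, V x -> ip x u = 0).
  by move=> c; have [x Vx hx] := uV c; exists x => //; split=> //; apply: pu.
move=> /existsNP[g0 /not_implyP[Vg0 /eqP gu0]].
have VZ a x : V x -> V (a *: x) by move=> Vx; rewrite -[_ *: _]addr0; apply: (Vl).
(* Every x in V is y + <x, u> g with y orthogonal to u, and this splitting is
   bounded, so a bound of the form on y would bound it on x. *)
pose g := (ip g0 u)^-1 *: g0.
have Vg : V g by apply: VZ.
have gu : ip g u = 1 by rewrite ipZl mulVf.
move=> c; apply: contrapT => nc.
(* Replacing [c] by its absolute value makes the bound monotone in [nm y]. *)
have {nc} hc y : V y -> ip y u = 0 -> form y <= `|c| * nm y ^+ 2.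
  move=> Vy yu; rewrite leNgt; apply/negP => h; apply: nc; exists y => //.
  by apply: le_lt_trans h; rewrite ler_wpM2r ?exprn_ge0 ?nm_ge0 // ler_norm.
pose U := nm u; pose G := nm g; pose N := nm (A g).
(* The three summands are the bounds [b1], twice [b2], and [b3] below, divided by [X ^+ 2]. *)
pose K := `|c| * (1 + U * G) ^+ 2 + 2 * U * N * (1 + U * G) + U ^+ 2 * N * G.
have [x Vx] := uV K; apply/negP; rewrite -leNgt.
pose a := ip x u; pose y := x - a *: g.
have Vy : V y by rewrite /y addrC -scaleNr; apply: (Vl).
have yu : ip y u = 0 by rewrite ipBl ipZl gu mulr1 subrr.
have xE : x = y + a *: g by rewrite subrK.
have Dy := VD _ Vy; have Dg := VD _ Vg.
have Dag := domZ a Dg.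
pose X := nm x; have X0 : 0 <= X by apply: nm_ge0.
have U0 : 0 <= U by apply: nm_ge0.
have G0 : 0 <= G by apply: nm_ge0.
have N0 : 0 <= N by apply: nm_ge0.
have aX : re `|a| <= U * X by rewrite mulrC; apply: norm_ip_le.
have yX : nm y <= (1 + U * G) * X.
  apply: le_trans (nmB _ _) _; rewrite nmZ mulrDl mul1r lerD2l mulrAC.
  exact: ler_wpM2r.
clearbody y.
have -> : form x = form y + 2 * (s * re (ip (a *: A g) y)) + s * re (ip (a *: A g) (a *: g)).
  rewrite /form {1 2}xE opD // opZ // ipDl !ipDr.
  have -> : ip (A y) (a *: g) = conjc (ip (a *: A g) y).
    by rewrite sa_sym // opZ // ipC.
  rewrite !ReD ReC; ring.
have b1 : form y <= `|c| * ((1 + U * G) * X) ^+ 2.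
  apply: le_trans (hc _ Vy yu) _; rewrite ler_wpM2l // ler_sqr ?nnegrE ?nm_ge0 //.
  by rewrite mulr_ge0 // addr_ge0 // mulr_ge0.
have b2 : s * re (ip (a *: A g) y) <= U * X * N * ((1 + U * G) * X).
  apply: le_trans (sRe_le _) _; apply: le_trans (norm_ip_le _ _) _.
  rewrite nmZ; apply: ler_pM => //; rewrite ?mulr_ge0 ?nm_ge0 ?Re_norm_ge0 //.
  exact: ler_wpM2r.
have b3 : s * re (ip (a *: A g) (a *: g)) <= U * X * N * (U * X * G).
  apply: le_trans (sRe_le _) _; apply: le_trans (norm_ip_le _ _) _.
  by rewrite !(nmZ a); apply: ler_pM; rewrite ?mulr_ge0 ?nm_ge0 ?Re_norm_ge0 //; apply: ler_wpM2r.
apply: le_trans (lerD (lerD b1 (ler_wpM2l _ b2)) b3) _ => //.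
rewrite le_eqVlt; apply/orP; left; apply/eqP; rewrite /K -/X; ring.
Qed.

Lemma unbounded_form_perp_seq (us : seq H) : unbounded_form (dom A) ->
  unbounded_form [set x | dom A x /\ forall u, u \in us -> ip x u = 0].
Proof.
move=> uA; elim: us => [|u us ih].
  by move=> c; have [x Dx hx] := uA c; exists x.
move=> c; have [] := @unbounded_form_perp _ u _ _ ih c.
- apply: submodP; first by split; [exact: dom0 | move=> *; rewrite ip0l].
  move=> a x y [Dx hx] [Dy hy]; split; first exact: domD.
  by move=> v vu; rewrite ipDl ipZl hx // hy // mulr0 addr0.
- by move=> x [].
move=> x [[Dx hx] xu] hc; exists x => //; split=> // v.
by rewrite inE => /orP[/eqP->//|/hx].
Qed.

Lemma formZ_real (t : R) x : dom A x -> form (t%:C *: x) = t ^+ 2 * form x.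
Proof.
by move=> Dx; rewrite /form opZ // ipZl ipZr conjc_real !ReM_real; ring.
Qed.

Lemma unit_perp (us : seq H) (c : R) : unbounded_form (dom A) ->
  exists f, [/\ dom A f, nm f = 1, c < form f & forall u, u \in us -> ip f u = 0].
Proof.
move=> uA; have [x [Dx hx] cx] := unbounded_form_perp_seq us uA c.
have x0 : 0 < nm x.
  rewrite lt_def nm_ge0 andbT; apply/eqP => /nm_eq0 x0; move: cx.
  by rewrite x0 /form ip0r nm0 mulr0 expr0n /= mulr0 ltxx.
exists ((nm x)^-1%:C *: x); split.
- exact: domZ.
- by rewrite nm_real ger0_norm ?invr_ge0 ?nm_ge0 // mulVf // gt_eqF.
- rewrite formZ_real // exprVn mulrC ltr_pdivlMr //; exact: exprn_gt0.
- by move=> u uu; rewrite ipZl hx // mulr0.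
Qed.

(** By induction: the new vector is also chosen orthogonal to every earlier [f j] and [A (f j)]; by
    symmetry of [A] the latter kills the cross terms of the form. *)
Lemma frame_perp n (us : seq H) (c : R) : unbounded_form (dom A) ->
  exists f : nat -> H, forall i, (i < n)%N ->
    [/\ dom A (f i), nm (f i) = 1, c < form (f i),
        forall u, u \in us -> ip (f i) u = 0
      & forall j, (j < n)%N -> i != j -> ip (f i) (f j) = 0 /\ ip (A (f i)) (f j) = 0].
Proof.
move=> uA; elim: n => [|n [f hf]]; first by exists (fun=> 0).
pose vs := us ++ [seq f j | j <- iota 0 n] ++ [seq A (f j) | j <- iota 0 n].
have [g [Dg g1 cg hg]] := unit_perp vs c uA.
have gus u : u \in us -> ip g u = 0 by move=> h; apply: hg; rewrite mem_cat h.
have gf j : (j < n)%N -> ip g (f j) = 0.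
  by move=> jn; apply: hg; rewrite !mem_cat map_f ?orbT // mem_iota.
have gAf j : (j < n)%N -> ip g (A (f j)) = 0.
  by move=> jn; apply: hg; rewrite !mem_cat (map_f (fun j => A (f j))) ?orbT // mem_iota.
exists (fun i => if i == n then g else f i) => i; rewrite ltnS leq_eqVlt.
have [-> _|ni /= iN] := eqVneq i n.
  split=> // j; rewrite ltnS leq_eqVlt eq_sym => /orP[->//|jn ne].
  rewrite (negPf ne) gf //; split=> //.
  by have [Dj _ _ _ _] := hf _ jn; rewrite sa_sym // gAf.
have [Di i1 ci hi ho] := hf _ iN; split=> // j; rewrite ltnS leq_eqVlt.
have [-> _ _|nj /= jn ij] := eqVneq j n; last exact: ho.
by split; apply: ip_eq0C; rewrite ?gf // gAf.
Qed.

End UnboundedForm.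

(** * Finite orthonormal families *)

Section Orthonormal.
Variables (R : realType) (H : hilbertType R).
Local Notation re := complex.Re.
Local Notation ip := (inner H).

(* Only the first [n] values of the sequence [h] are relevant; indexing by [nat]
   lets families be extended without dependent types. *)
Definition orthonormal_upto n (h : nat -> H) := forall i j, (i < n)%N -> (j < n)%N ->
  ip (h i) (h j) = (i == j)%:R.

Definition lcomb n (h : nat -> H) (c : nat -> R[i]) : H := \sum_(i < n) c i *: h i.
Definition fourier n (h : nat -> H) (x : H) : H := lcomb n h (fun i => ip x (h i)).
(* For orthonormal [h], the span is the set of fixed points of the projection. *)
Definition spanned n (h : nat -> H) : set H := [set x | fourier n h x = x].

Variables (n : nat) (h : nat -> H).

Lemma eq_lcomb c c' : (forall i, (i < n)%N -> c i = c' i) -> lcomb n h c = lcomb n h c'.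
Proof. by move=> e; apply: eq_bigr => i _; rewrite e. Qed.

Lemma lcombD c c' a : lcomb n h (fun i => a * c i + c' i) = a *: lcomb n h c + lcomb n h c'.
Proof.
rewrite scaler_sumr -big_split; apply: eq_bigr => i _ /=.
by rewrite scalerDl scalerA.
Qed.

Lemma fourierD a x y : fourier n h (a *: x + y) = a *: fourier n h x + fourier n h y.
Proof. by rewrite -lcombD; apply: eq_lcomb => i _; rewrite ipDl ipZl. Qed.

Lemma fourierB x y : fourier n h (x - y) = fourier n h x - fourier n h y.
Proof. by rewrite -scaleN1r addrC fourierD scaleN1r addrC. Qed.

Lemma ip_lcombl c x : ip (lcomb n h c) x = \sum_(i < n) c i * ip (h i) x.
Proof. by rewrite ip_suml; apply: eq_bigr => i _; rewrite ipZl. Qed.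

Lemma ip_lcombr c x : ip x (lcomb n h c) = \sum_(i < n) conjc (c i) * ip x (h i).
Proof. by rewrite ip_sumr; apply: eq_bigr => i _; rewrite ipZr. Qed.

Lemma ip_fourier_perp x y : (forall i, (i < n)%N -> ip x (h i) = 0) ->
  ip x (fourier n h y) = 0.
Proof. by move=> e; rewrite ip_lcombr big1 // => i _; rewrite e // mulr0. Qed.

Hypothesis hO : orthonormal_upto n h.

Lemma ip_lcomb_basis c j : (j < n)%N -> ip (lcomb n h c) (h j) = c j.
Proof.
move=> jn; rewrite ip_lcombl (bigD1 (Ordinal jn)) //= hO // eqxx mulr1 big1 ?addr0 // => i ij.
by rewrite hO //= (_ : (i : nat) == j = false) ?mulr0 //; exact/negbTE.
Qed.

Lemma spanned_lcomb c : spanned n h (lcomb n h c).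
Proof. by apply: eq_lcomb => i iN; rewrite ip_lcomb_basis. Qed.

Lemma spanned_fourier x : spanned n h (fourier n h x).
Proof. exact: spanned_lcomb. Qed.

Lemma spanned_basis j : (j < n)%N -> spanned n h (h j).
Proof.
move=> jn; have -> : h j = lcomb n h (fun i => (i == j)%:R); last exact: spanned_lcomb.
rewrite /lcomb (bigD1 (Ordinal jn)) //= eqxx scale1r big1 ?addr0 // => i ij.
by rewrite (_ : (i : nat) == j = false) ?scale0r //; exact/negbTE.
Qed.

Lemma nm_basis j : (j < n)%N -> nm (h j) = 1.
Proof.
move=> jn; have := hO jn jn; rewrite eqxx ip_nm => /(congr1 (@complex.Re R)) /= /eqP.
by rewrite sqrf_eq1 => /orP[/eqP//|/eqP e]; have := nm_ge0 (h j); rewrite e lerNr oppr0 ler10.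
Qed.

Lemma nm_lcomb_sq c : nm (lcomb n h c) ^+ 2 = \sum_(i < n) (re `|c i|) ^+ 2.
Proof.
apply: (@complexI R); rewrite -ip_nm ip_lcombl rmorph_sum; apply: eq_bigr => i _ /=.
by rewrite ipC ip_lcomb_basis // -sqr_normc normcRe rmorphXn.
Qed.

Lemma le_nm_lcomb c i : (i < n)%N -> re `|c i| <= nm (lcomb n h c).
Proof.
move=> iN; rewrite -ler_sqr ?nnegrE ?nm_ge0 ?Re_norm_ge0 // nm_lcomb_sq.
rewrite (bigD1 (Ordinal iN)) //= lerDl sumr_ge0 // => j _; exact: sqr_ge0.
Qed.

Lemma spanned_submod : submod_closed (mem (spanned n h)).
Proof.
apply: submodP; last by move=> a x y hx hy; rewrite /spanned /= fourierD hx hy.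
by rewrite /spanned /= /fourier /lcomb big1 // => i _; rewrite ip0l scale0r.
Qed.

Lemma fourier_perp x v : spanned n h v -> ip (x - fourier n h x) v = 0.
Proof.
move=> <-; apply: ip_fourier_perp => i iN.
by rewrite ipBl ip_lcomb_basis // subrr.
Qed.

(** Uniqueness: the difference [d] of two candidates lies in the span and is orthogonal to it, hence
    to itself. *)
Lemma orthoproj_spanned x : orthoproj (spanned n h) x = fourier n h x.
Proof.
apply: xget_unique; first by split; [exact: spanned_fourier | exact: fourier_perp].
move=> y [Ly hy].
have Lf := spanned_fourier x.
set d := y - fourier n h x.
have Ld : spanned n h d by rewrite /spanned /= fourierB Ly Lf.
have : ip d d = 0.
  rewrite {1}(_ : d = (x - fourier n h x) - (x - y)); first by rewrite ipBl fourier_perp ?hy ?subrr.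
  by rewrite opprB [RHS]addrC addrA subrK.
rewrite ip_nm => /(congr1 (@complex.Re R)) /= /eqP; rewrite sqrf_eq0 => /eqP /nm_eq0 /eqP.
by rewrite subr_eq0 => /eqP.
Qed.

Lemma nm_fourier_le x : nm (fourier n h x) <= nm x.
Proof.
have := nmD_sq (x - fourier n h x) (fourier n h x).
rewrite subrK (fourier_perp _ (spanned_fourier x)) /= mulr0 addr0 => e.
by rewrite -ler_sqr ?nnegrE ?nm_ge0 // e lerDr sqr_ge0.
Qed.

(** The projection is a contraction, so [fourier n h p - p] has norm at most twice the distance from
    [p] to any vector of the span. *)
Lemma spanned_closed : closed (spanned n h).
Proof.
apply: closed_nm => p hp.
apply/eqP; rewrite -subr_eq0; apply/eqP; apply: nm_eq0; apply/eqP.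
rewrite eq_le nm_ge0 andbT; apply: le_addeps => e e0; rewrite add0r.
have [v Lv vp] := hp (e / 2) ltac:(by rewrite divr_gt0).
have -> : fourier n h p - p = (v - p) - fourier n h (v - p).
  by rewrite fourierB Lv opprB [RHS]addrC addrA subrK.
apply: le_trans (nmB _ _) _; have := nm_fourier_le (v - p); lra.
Qed.

End Orthonormal.

Lemma lcomb_rcons (R : realType) (H : hilbertType R) n (h : nat -> H) c g :
  lcomb n.+1 (fun i => if i == n then g else h i) c = lcomb n h c + c n *: g.
Proof.
rewrite /lcomb big_ord_recr /= eqxx; congr (_ + _); apply: eq_bigr => i _.
by rewrite (ltn_eqF (ltn_ord i)).
Qed.

(** The family [e] may be linearly dependent, so [m] can be smaller than [n]. *)
Lemma gram_schmidt (R : realType) (H : hilbertType R) n (e : nat -> H) :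
  exists m (h : nat -> H), orthonormal_upto m h /\ [set x | exists c, x = lcomb n e c] = spanned m h.
Proof.
elim: n => [|n [m [h [hO E]]]].
  exists 0%N, e; split=> //; apply/seteqP; split=> x.
    by move=> [c ->]; rewrite /spanned /= /fourier /lcomb !big_ord0.
  by rewrite /spanned /= => <-; exists (fun=> 0); rewrite /fourier /lcomb !big_ord0.
have Ein c : spanned m h (lcomb n e c) by rewrite -E; exists c.
have Eout x : spanned m h x -> exists c, x = lcomb n e c by rewrite -E.
pose w := e n - fourier m h (e n).
have lS c : lcomb n.+1 e c = lcomb n e c + c n *: e n by rewrite /lcomb big_ord_recr.
(* If the residual [w] vanishes, [e n] already lies in the span and [h] is kept; otherwise the
   normalized residual is appended. *)
have [w0|w0] := eqVneq (nm w) 0.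
  exists m, h; split=> //; apply/seteqP; split=> x.
    move=> [c ->]; rewrite lS /spanned /= addrC fourierD Ein.
    by have /eqP := nm_eq0 w0; rewrite subr_eq0 => /eqP <-.
  move=> /Eout [c ->]; exists (fun i => if i == n then 0 else c i).
  rewrite lS eqxx scale0r addr0; apply: eq_lcomb => i iN.
  by rewrite (ltn_eqF iN).
have wh j : (j < m)%N -> inner H w (h j) = 0.
  by move=> jm; apply: fourier_perp => //; apply: spanned_basis.
pose g := (nm w)^-1%:C *: w.
have gh j : (j < m)%N -> inner H g (h j) = 0 by move=> jm; rewrite ipZl wh // mulr0.
have eE : e n = (nm w)%:C *: g + fourier m h (e n).
  by rewrite scalerA -rmorphM /= mulfV // scale1r subrK.
have g1 : nm g = 1 by rewrite nm_real ger0_norm ?invr_ge0 ?nm_ge0 // mulVf.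
pose k i := if i == m then g else h i.
have kO : orthonormal_upto m.+1 k.
  move=> i j; rewrite ltnS leq_eqVlt => hi; rewrite ltnS leq_eqVlt; move: hi; rewrite /k.
  have [->|ni] := eqVneq i m; have [->|nj] := eqVneq j m => /=.
  - by move=> _ _; rewrite ip_nm g1 expr1n.
  - by move=> _ jm; rewrite gh // eq_sym (negPf nj).
  - by move=> im _; rewrite (negPf ni); apply/ip_eq0C/gh.
  - exact: hO.
have khE x : fourier m.+1 k x = fourier m h x + inner H x g *: g.
  rewrite /fourier lcomb_rcons /k eqxx; congr (_ + _); apply: eq_lcomb => i im.
  by rewrite (ltn_eqF im).
have Lk x : spanned m h x -> spanned m.+1 k x.
  move=> hx; rewrite /spanned /= khE hx -{1 2}hx ip_eq0C ?scale0r ?addr0 //.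
  exact: ip_fourier_perp gh.
have Lg : spanned m.+1 k g by have := spanned_basis kO (ltnSn m); rewrite /k eqxx.
have [_ LD] := submod_set (spanned_submod m.+1 k).
exists m.+1, k; split=> //; apply/seteqP; split=> x.
  move=> [c ->]; rewrite lS addrC; apply: (LD); last exact/Lk.
  rewrite eE; apply: (LD) => //; exact/Lk/spanned_fourier.
rewrite /spanned /= khE => <-.
have [c1 ->] := Eout _ (spanned_fourier hO x).
have [c2 e2] := Eout _ (spanned_fourier hO (e n)).
(* Since [g] is [w] divided by its norm, [b] is the coefficient of [e n] in [x]; the lower
   coefficients are corrected by the expansion [c2] of the projection of [e n]. *)
pose b := inner H x g / (nm w)%:C.
have -> : inner H x g *: g = b *: (e n - lcomb n e c2).
  rewrite -e2 {1}eE addrK [RHS]scalerA divfK //.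
  by rewrite -(rmorph0 (real_complex R)) (inj_eq (@complexI R)).
exists (fun i => if i == n then b else - b * c2 i + c1 i).
rewrite lS eqxx scalerBr addrA addrAC; congr (_ + _).
rewrite [RHS](@eq_lcomb _ _ _ _ _ (fun i => - b * c2 i + c1 i)); last first.
  by move=> i iN; rewrite /= (ltn_eqF iN).
by rewrite lcombD scaleNr addrC.
Qed.

Lemma finite_dimensional_orthonormal (R : realType) (H : hilbertType R) (L : set H) :
  finite_dimensional L -> exists m (h : nat -> H), orthonormal_upto m h /\ L = spanned m h.
Proof.
move=> [n [e ->]].
(* Extension by 0 to all indices; sums over ['I_n] never reach the default. *)
pose e' k := if insub k is Some i then e i else 0.
have [m [h [hO E]]] := gram_schmidt n e'.
exists m, h; split=> //; rewrite -E; apply/seteqP; split=> x [c ->].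
  exists (fun k => if insub k is Some i then c i else 0).
  by apply: eq_bigr => i _; rewrite /e' valK.
by exists (fun i => c i); apply: eq_bigr => i _; rewrite /e' valK.
Qed.

(** * Compressions and the perturbation of a subspace *)

Section Compression.
Variables (R : realType) (H : hilbertType R) (A : operator H).
Hypothesis sA : self_adjoint A.
Variable s : R.
Hypothesis s1 : `|s| = 1.
Local Notation re := complex.Re.
Local Notation ip := (inner H).

Lemma lcomb_dom n (h : nat -> H) c : (forall i, (i < n)%N -> dom A (h i)) ->
  dom A (lcomb n h c) /\ A (lcomb n h c) = lcomb n (A \o h) c.
Proof.
elim: n => [|n ih] hD; first by rewrite /lcomb !big_ord0 op0; split=> //; apply: dom0.
have [D E] := ih (fun i iN => hD i (ltnW iN)).
rewrite /lcomb !big_ord_recr /= -!/(lcomb _ _ _); split.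
  by apply: domA => //; apply: domZ; apply: hD.
by rewrite opD ?opZ -/(lcomb _ _ _) ?E //; [apply: hD | apply: domZ; apply: hD].
Qed.

Lemma lcombZD n (g h : nat -> H) (a b : R[i]) c :
  lcomb n (fun i => a *: g i + b *: h i) c = a *: lcomb n g c + b *: lcomb n h c.
Proof.
rewrite /lcomb !scaler_sumr -big_split; apply: eq_bigr => i _ /=.
by rewrite scalerDr !scalerA (mulrC a) (mulrC b).
Qed.

(** In finite dimension a spectral point [z] is an eigenvalue. An eigenvector [u] gives
    [z * nm u ^+ 2 = ip (A u) u], which is real, and the form bound at [u] then bounds
    [s * re z]. *)
Lemma SpecIn_spanned n (h : nat -> H) (r : R) (z : R[i]) :
  orthonormal_upto n h -> (forall i, (i < n)%N -> dom A (h i)) ->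
  (forall u, spanned n h u -> u != 0 -> r * nm u ^+ 2 < form A s u) ->
  SpecIn A (spanned n h) z -> exists x : R, z = x%:C /\ r < s * x.
Proof.
move=> hO hD hr; apply: contraPP => nz; rewrite /SpecIn /spectrum /= => hz; apply: hz.
(* [B] is the matrix, acting on row vectors, of the compression minus [z]; the
   strict bound on the form makes its kernel trivial. *)
pose B : 'M[R[i]]_n := \matrix_(j, i) (ip (A (h j)) (h i) - z * (i == j)%:R).
pose vec (c : 'rV[R[i]]_n) : nat -> R[i] := fun i => if insub i is Some k then c 0 k else 0.
have vecE c (i : 'I_n) : vec c i = c 0 i by rewrite /vec valK.
pose L c := lcomb n h (vec c).
have LD c : dom A (L c) by case: (lcomb_dom (vec c) hD).
have TB c : fourier n h (A (L c)) - z *: L c = L (c *m B).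
  have [_ E] := lcomb_dom (vec c) hD.
  rewrite /L {1}E -scaleNr addrC -lcombD; apply: eq_bigr => i _; congr (_ *: _).
  rewrite vecE ip_lcombl (vecE (c *m B)) mxE.
  rewrite [RHS](_ : _ = \sum_(j < n) c 0 j * ip (A (h j)) (h i) - \sum_(j < n) z * (c 0 j * (i == j)%:R)).
    rewrite [X in _ = _ - X](bigD1 i) //= eqxx mulr1 [X in _ - (_ + X)]big1 ?addr0.
      rewrite addrC mulNr; congr (_ - _); apply: eq_bigr => j _.
      by rewrite vecE.
    by move=> j ji; rewrite eq_sym (negPf ji) !mulr0.
  rewrite -sumrB; apply: eq_bigr => j _.
  by rewrite mxE mulrBr; congr (_ - _); rewrite mulrCA.
have Lin c : spanned n h (L c) by apply: spanned_lcomb.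
have L0 c : L c = 0 -> c = 0.
  move=> c0; apply/rowP => i; rewrite mxE -vecE -(ip_lcomb_basis hO (vec c) (ltn_ord i)).
  by rewrite -/(L c) c0 ip0l.
have Bu : B \in unitmx.
  rewrite -row_free_unit; apply/row_freeP; apply/row_freeP.
  apply: inj_row_free => c cB; apply: L0; apply: contrapT => /eqP u0.
  have e : fourier n h (A (L c)) = z *: L c.
    apply/eqP; rewrite -subr_eq0 TB cB /L /lcomb big1 // => i _.
    by rewrite vecE mxE scale0r.
  have e2 : ip (A (L c)) (L c) = z * (nm (L c) ^+ 2)%:C.
    rewrite -ip_nm -ipZl -e; apply/eqP; rewrite -subr_eq0 -ipBl.
    by rewrite fourier_perp.
  have n0 : 0 < nm (L c) ^+ 2.
    rewrite exprn_gt0 // lt_def nm_ge0 andbT; apply/eqP => /nm_eq0 /eqP.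
    exact/negP.
  have := form_real sA (LD c); rewrite e2 => e3.
  have zE : z = (re z)%:C.
    have n0C : (nm (L c) ^+ 2)%:C != 0 :> R[i].
      by rewrite -(rmorph0 (real_complex R)) (inj_eq (@complexI R)) gt_eqF.
    by apply: (mulIf n0C); rewrite e3 mulrC ReM_real -rmorphM /= mulrC.
  apply: nz; exists (re z); split=> //.
  have := hr _ (Lin c) u0; rewrite /form e2 (mulrC z) ReM_real.
  by rewrite (mulrCA s) (mulrC _ (s * _)) ltr_pM2r.
pose V y : 'rV[R[i]]_n := \row_i ip y (h i).
have LV y : spanned n h y -> L (V y) = y.
  move=> <-; rewrite /L; apply: eq_bigr => i _; rewrite vecE mxE.
  by rewrite ip_lcomb_basis.
have VL c : V (L c) = c.
  by apply/rowP => i; rewrite mxE ip_lcomb_basis // vecE.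
exists (fun y => L (V y *m invmx B)); split.
- move=> y Ly; split=> //.
  by rewrite orthoproj_spanned // TB mulmxKV // LV.
- move=> x Lx; rewrite orthoproj_spanned // -(LV _ Lx) TB; split=> //.
  by rewrite !VL mulmxK.
(* Each coordinate of [y] is at most [nm y] in modulus, so the sum of the moduli of the entries of
   the inverse matrix bounds the resolvent. *)
- exists (\sum_(i < n) \sum_(j < n) re `|invmx B j i|) => y Ly.
  rewrite !nmE -rmorphM lecR mulr_suml; apply: le_trans (nm_sum _ _) _.
  apply: ler_sum => i _; rewrite nmZ (nm_basis hO (ltn_ord i)) mulr1 vecE mxE.
  rewrite mulr_suml -lecR -normcRe rmorph_sum; apply: le_trans (ler_norm_sum _ _ _) _.
  apply: ler_sum => j _; rewrite normrM mxE (normcRe (ip _ _)) (normcRe (invmx _ _ _)) -rmorphM lecR /= mulrC.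
  rewrite ler_wpM2l ?Re_norm_ge0 //.
  by apply: le_trans (norm_ip_le _ _) _; rewrite (nm_basis hO) ?mulr1.
Qed.

(** Each rank-one difference splits into [ip x (g i - h i) *: g i] and [ip x (h i) *: (g i - h i)],
    both of norm at most [d * nm x]. *)
Lemma nm_fourier_dist n (g h : nat -> H) (d : R) :
  (forall i, (i < n)%N -> [/\ nm (g i) = 1, nm (h i) = 1 & nm (g i - h i) <= d]) ->
  forall x, nm (fourier n g x - fourier n h x) <= n%:R * (2 * d) * nm x.
Proof.
move=> gh x; rewrite /fourier /lcomb -sumrB.
apply: le_trans (nm_sum _ _) _.
rewrite -mulrA -[n in n%:R]card_ord mulr_natl -sumr_const; apply: ler_sum => i _.
have [g1 h1 gd] := gh i (ltn_ord i).
have -> : ip x (g i) *: g i - ip x (h i) *: h i =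
    ip x (g i - h i) *: g i + ip x (h i) *: (g i - h i).
  by rewrite ipBr scalerBl scalerBr addrA subrK.
apply: le_trans (nmD _ _) _; rewrite !nmZ g1 mulr1.
have d0 : 0 <= d by apply: le_trans gd; apply: nm_ge0.
have b1 : re `|ip x (g i - h i)| <= nm x * d.
  by apply: le_trans (norm_ip_le _ _) _; rewrite ler_wpM2l ?nm_ge0.
have b2 : re `|ip x (h i)| * nm (g i - h i) <= nm x * d.
  apply: ler_pM; rewrite ?Re_norm_ge0 ?nm_ge0 //.
  by apply: le_trans (norm_ip_le _ _) _; rewrite h1 mulr1.
lra.
Qed.

(** The factor [eps / 2] leaves room for a strict inequality after taking the supremum over the unit
    ball. *)
Lemma perturbation (L : set H) (eps r : R) :
  unbounded_form A s (dom A) -> finite_dimensional L -> L `<=` dom A -> 0 < eps ->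
  exists L' : set H,
    [/\ closed_subspace L', L' `<=` dom A,
        forall x, nm (orthoproj L x - orthoproj L' x) <= eps / 2 * nm x
      & forall z, SpecIn A L' z -> exists x : R, z = x%:C /\ r < s * x].
Proof.
move=> uA fL LDom e0.
have [n [e [eO LE]]] := finite_dimensional_orthonormal fL; subst L.
have eD i : (i < n)%N -> dom A (e i) by move=> iN; apply: LDom; apply: spanned_basis.
(* Each [e i] will move by at most [2 * t], hence the projection by [4 * n * t], which is at most
   [eps / 2]. The minimum with 1 keeps [1 - t ^+ 2] nonnegative, and [n.+1] covers [n = 0]. *)
pose t : R := Num.min 1 (eps / (8 * n.+1%:R)).
have t0 : 0 < t by rewrite lt_min ltr01 divr_gt0 // mulr_gt0.
have t1 : t <= 1 by rewrite ge_min lexx.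
have te : n%:R * (2 * (2 * t)) <= eps / 2.
  have : t <= eps / (8 * n.+1%:R) by rewrite ge_min lexx orbT.
  rewrite ler_pdivlMr ?mulr_gt0 // -natr1.
  by have := mulr_ge0 (ler0n R n) (ltW t0); lra.
pose c := Num.sqrt (1 - t ^+ 2).
have c0 : 0 <= c by apply: sqrtr_ge0.
have ct : c ^+ 2 + t ^+ 2 = 1.
  by rewrite sqr_sqrtr ?subrK // subr_ge0 expr_le1 // ltW.
have c1 : c <= 1 by rewrite -[leRHS]sqrtr1 ler_sqrt // lerBlDr lerDl sqr_ge0.
have ct1 : 1 - c <= t by nra.
pose K := \sum_(i < n) nm (A (e i)).
have K0 : 0 <= K by apply: sumr_ge0 => i _; apply: nm_ge0.
(* Chosen so that [t ^+ 2 * M - K = |r| + 1], which exceeds [r]. *)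
pose M := (`|r| + K + 1) / t ^+ 2.
pose us := [seq e i | i <- iota 0 n] ++ [seq A (e i) | i <- iota 0 n].
have [f hf] := frame_perp sA s1 n us M uA.
have fD i : (i < n)%N -> dom A (f i) by move=> /hf [].
have fe i j : (i < n)%N -> (j < n)%N -> ip (f i) (e j) = 0 /\ ip (f i) (A (e j)) = 0.
  move=> /hf [_ _ _ h _] jn; split; apply: h; rewrite mem_cat.
    by rewrite map_f // mem_iota.
  by rewrite (map_f (fun j => A (e j))) ?orbT // mem_iota.
have fO : orthonormal_upto n f.
  move=> i j iN jn; have [_ f1 _ _ h] := hf _ iN.
  have [<-|ij] := eqVneq i j; first by rewrite ip_nm f1 expr1n.
  by have [-> _] := h _ jn ij.
pose h i := c%:C *: e i + t%:C *: f i.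
have hD i : (i < n)%N -> dom A (h i).
  by move=> iN; apply: domD; [exact: eD | apply: domZ; exact: fD].
have hO : orthonormal_upto n h.
  move=> i j iN jn; rewrite ipDl !ipDr !ipZl !ipZr !conjc_real eO // fO //.
  have [-> _] := fe _ _ iN jn.
  have -> : ip (e i) (f j) = 0 by apply: ip_eq0C; have [] := fe _ _ jn iN.
  rewrite !mulr0 addr0 add0r !mulrA -mulrDl -!rmorphM -rmorphD /= -!expr2 ct.
  by rewrite rmorph1 mul1r.
exists (spanned n h); split.
- by split; [apply: spanned_submod | apply: spanned_closed].
- by move=> x <-; case: (lcomb_dom (fun i => ip x (h i)) hD).
- move=> x; rewrite !orthoproj_spanned //.
  apply: le_trans (@nm_fourier_dist n e h (2 * t) _ x) _.
    move=> i iN; have f1 := nm_basis fO iN; have e1 := nm_basis eO iN; split=> //.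
      exact: (nm_basis hO iN).
    have -> : e i - h i = (1 - c)%:C *: e i - t%:C *: f i.
      by rewrite /h opprD addrA rmorphB /= rmorph1 scalerBl scale1r.
    apply: le_trans (nmB _ _) _; rewrite !nm_real e1 f1 !mulr1.
    rewrite !ger0_norm ?subr_ge0 //; [lra | exact: ltW].
  by rewrite ler_wpM2r ?nm_ge0.
move=> z; apply: (SpecIn_spanned hO hD) => u uE u0.
pose a i := ip u (h i).
have uL : u = lcomb n h a by rewrite -[LHS]uE.
(* The three families [e], [f] and [h] are orthonormal, so [p], [q] and [u], sharing the coordinates
   [a], have equal norms. *)
pose p := lcomb n e a; pose q := lcomb n f a.
have uPQ : u = c%:C *: p + t%:C *: q by rewrite uL lcombZD.
have pn : nm p ^+ 2 = nm u ^+ 2 by rewrite uL !nm_lcomb_sq.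
have qn : nm q ^+ 2 = nm u ^+ 2 by rewrite uL !nm_lcomb_sq.
have un : 0 < nm u ^+ 2.
  by rewrite exprn_gt0 // lt_def nm_ge0 andbT; apply: contraNneq u0 => /nm_eq0 ->.
have [pD Ap] := lcomb_dom a eD; have [qD Aq] := lcomb_dom a fD.
rewrite -/p -/q in pD Ap qD Aq.
have qAp : ip q (A p) = 0.
  rewrite Ap ip_lcombr big1 // => j _; rewrite ip_lcombl big1 ?mulr0 // => i _.
  by have [_ /= ->] := fe _ _ (ltn_ord i) (ltn_ord j); rewrite mulr0.
have Aqp : ip (A q) p = 0 by rewrite sa_sym.
have fE : form A s u = c ^+ 2 * form A s p + t ^+ 2 * form A s q.
  rewrite /form uPQ opD ?opZ //; try exact: domZ.
  rewrite ipDl !ipDr !ipZl !ipZr !conjc_real (ip_eq0C qAp) Aqp !mulr0 addr0 add0r.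
  by rewrite ReD !ReM_real; ring.
have pF : - (K * nm u ^+ 2) <= form A s p.
  have Apn : nm (A p) <= K * nm p.
    rewrite Ap; apply: le_trans (nm_sum _ _) _; rewrite mulr_suml.
    apply: ler_sum => i _; rewrite nmZ mulrC ler_wpM2l ?nm_ge0 //.
    exact: (le_nm_lcomb eO).
  rewrite lerNl; have := sRe_le s1 (- ip (A p) p); rewrite ReN mulrN normrN => /le_trans; apply.
  apply: le_trans (norm_ip_le _ _) _; rewrite -pn expr2 mulrA.
  by rewrite ler_wpM2r ?nm_ge0.
(* The form is diagonal on the [f i], with diagonal entries above [M]. *)
have qF : M * nm u ^+ 2 <= form A s q.
  have -> : form A s q = \sum_(i < n) (re `|a i|) ^+ 2 * form A s (f i).
    rewrite /form Aq ip_lcombl -[RHS]mulr1.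
    have -> : \sum_(i < n) a i * ip (A (f i)) q = \sum_(i < n) ((re `|a i|) ^+ 2)%:C * ip (A (f i)) (f i).
      apply: eq_bigr => i _ /=; rewrite ip_lcombr (bigD1 i) //= big1 ?addr0.
        by rewrite mulrA -sqr_normc normcRe rmorphXn.
      move=> j ji; have [_ _ _ _ /(_ _ (ltn_ord j))] := hf _ (ltn_ord i).
      by rewrite eq_sym => /(_ ji) [_ ->]; rewrite mulr0.
    rewrite (_ : re (\sum_(i < n) _) = \sum_(i < n) re ((re `|a i| ^+ 2)%:C * ip (A (f i)) (f i))); last first.
      by apply: (big_morph (@complex.Re R) (@ReD R)).
    rewrite mulr1 mulr_sumr; apply: eq_bigr => i _.
    by rewrite ReM_real mulrCA.
  rewrite -qn nm_lcomb_sq // mulr_sumr; apply: ler_sum => i _.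
  have [_ _ /ltW h1 _ _] := hf _ (ltn_ord i).
  by rewrite mulrC ler_wpM2l ?sqr_ge0.
have tM : t ^+ 2 * M = `|r| + K + 1 by rewrite mulrC divfK // expf_neq0 // gt_eqF.
rewrite fE.
have b1 : - (K * nm u ^+ 2) <= c ^+ 2 * form A s p.
  apply: le_trans (ler_wpM2l (sqr_ge0 c) pF); rewrite mulrN lerN2 ler_piMl //.
    by rewrite mulr_ge0 // ltW.
  by rewrite expr_le1.
have b2 := ler_wpM2l (sqr_ge0 t) qF; rewrite mulrA tM in b2.
have := ler_norm r; nra.
Qed.

End Compression.

(** * Passage to sequences of subspaces, and the two signs *)

Section Sequences.
Variables (R : realType) (H : hilbertType R) (A : operator H).
Hypothesis sA : self_adjoint A.

Lemma unbounded_form_above : unbounded_above A -> unbounded_form A 1 (dom A).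
Proof.
move=> uA c; apply: contrapT => nc; apply: uA; exists c => _ [z zA <-].
rewrite -[complex.Re z]mul1r; apply: (Spec_le sA (normr1 R) _ zA) => x Dx.
by rewrite leNgt; apply/negP => h; apply: nc; exists x.
Qed.

Lemma unbounded_form_below : unbounded_below A -> unbounded_form A (-1) (dom A).
Proof.
move=> uA c; apply: contrapT => nc; apply: uA; exists (- c) => _ [z zA <-].
rewrite lerNl -mulN1r; apply: (Spec_le sA _ _ zA); first by rewrite normrN1.
by move=> x Dx; rewrite leNgt; apply/negP => h; apply: nc; exists x.
Qed.

(** Each [L k] is perturbed separately. Strong convergence survives because the two projections of
    [x] differ by at most [eps k / 2 * nm x], which tends to 0. *)
Lemma perturbation_seq (s : R) (L : nat -> set H) (eps r : nat -> R) :
  `|s| = 1 -> unbounded_form A s (dom A) ->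
  Lambda A L -> (forall k, finite_dimensional (L k)) ->
  (forall k, 0 < eps k) -> eps @ \oo --> (0 : R) ->
  exists L' : nat -> set H, Lambda A L' /\ forall k,
    (opnorm (fun x => orthoproj (L k) x - orthoproj (L' k) x)%R < (eps k)%:E)%E /\
    forall z, SpecIn A (L' k) z -> exists x : R, z = x%:C /\ r k < s * x.
Proof.
move=> s1 uA [LA Lcvg] fL e0 ecvg.
have ex k := perturbation sA s1 (r k) uA (fL k) (LA k).2 (e0 k).
have [L' hL'] := choice ex.
exists L'; split; last first.
  move=> k; have [_ _ hd hs] := hL' k; split=> //.
  apply: (@le_lt_trans _ _ (eps k / 2)%:E); last by rewrite lte_fin; have := e0 k; lra.
  apply: ge_ereal_sup => _ [x /= x1 <-]; rewrite lee_fin.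
  apply: le_trans (hd x) _; apply: ler_piMr; first by rewrite divr_ge0 // ltW.
  by rewrite -lecR -nmE.
split; first by move=> k; have [cL' LD _ _] := hL' k.
move=> x; apply/cvg_nmP => e ep.
have [N1 hN1] := (cvg_nmP _ _).1 (Lcvg x) (e / 2) ltac:(lra).
have K0 : 0 < nm x + 1 by have := nm_ge0 x; lra.
(* Adding 1 to [nm x] allows division when [x = 0]; past this threshold [eps k / 2 * nm x] is below
   [e / 2]. *)
move/cvgrPdist_lt : ecvg => /(_ (e / (nm x + 1))) [|N2 _ hN2]; first exact: divr_gt0.
exists (maxn N1 N2) => k; rewrite geq_max => /andP[/hN1 k1 /hN2 /=].
rewrite sub0r normrN gtr0_norm // ltr_pdivlMr // => k2.
have [_ _ hd _] := hL' k; have := hd x.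
have -> : orthoproj (L' k) x - x =
    (orthoproj (L k) x - x) - (orthoproj (L k) x - orthoproj (L' k) x).
  by rewrite opprB [RHS]addrC addrA subrK.
have := nmB (orthoproj (L k) x - x) (orthoproj (L k) x - orthoproj (L' k) x).
have := e0 k; lra.
Qed.

End Sequences.

Theorem theorem2p2 (R : realType) (H : hilbertType R) (A : operator H) :
  separable H -> self_adjoint A ->
  (unbounded_above A ->
   forall (L : nat -> set H) (eps r : nat -> R),
     Lambda A L -> (forall k, finite_dimensional (L k)) ->
     (forall k, 0 < eps k) -> nonincreasing_seq eps ->
     eps @ \oo --> (0 : R) ->
     nondecreasing_seq r -> r @ \oo --> +oo ->
     exists L' : nat -> set H, Lambda A L' /\
       forall k,
         (opnorm (fun x => orthoproj (L k) x - orthoproj (L' k) x)%R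
            < (eps k)%:E)%E /\
         SpecIn A (L' k) `<=` [set x%:C | x in `]r k, +oo[]) /\
  (unbounded_below A ->
   forall (L : nat -> set H) (eps r : nat -> R),
     Lambda A L -> (forall k, finite_dimensional (L k)) ->
     (forall k, 0 < eps k) -> nonincreasing_seq eps ->
     eps @ \oo --> (0 : R) ->
     nondecreasing_seq r -> r @ \oo --> +oo ->
     exists L' : nat -> set H, Lambda A L' /\
       forall k,
         (opnorm (fun x => orthoproj (L k) x - orthoproj (L' k) x)%R
            < (eps k)%:E)%E /\
         SpecIn A (L' k) `<=` [set x%:C | x in `]-oo, - r k[]).
Proof.
move=> _ sA; split=> uA L eps r LA fL e0 _ ecvg _ _.
- have [L' [L'A hL']] := perturbation_seq sA r (normr1 R) (unbounded_form_above sA uA) LA fL e0 ecvg.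
  exists L'; split=> // k; have [? hs] := hL' k; split=> // z /hs [x [-> rx]].
  by exists x => //; rewrite /= in_itv /= andbT -[x]mul1r.
- have [L' [L'A hL']] := perturbation_seq sA r (normrN1 R) (unbounded_form_below sA uA) LA fL e0 ecvg.
  exists L'; split=> // k; have [? hs] := hL' k; split=> // z /hs [x [-> rx]].
  by exists x => //; rewrite /= in_itv /= ltrNr -mulN1r.
Qed.
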